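(* Let $k\ge 1$ be an integer and let $G$ be a $k$-connected graph on $n$ vertices. If $k\geq (n-2)/3$, then every two longest paths $P$ and $Q$ in $G$ satisfy $|V(P)\cap V(Q)|\ge k$.
   Context: All graphs are finite and simple (no loops, no parallel edges). Paths are simple (no repeated vertices or edges). The length of a path is its number of edges, and a longest path in a graph is a path of maximum length among all paths in the graph. Two paths with the same two extremes are internally disjoint if they have no internal vertices in common. A graph $G$ (with at least two vertices) is $k$-connected if, for any two distinct vertices $u$ and $v$ of $G$, there exists a set of $k$ distinct pairwise internally disjoint $u$-$v$ paths. *)

(* Defs.v *)
From mathcomp Require Import all_boot.
Set Implicit Arguments.
Unset Strict Implicit.
Unset Printing Implicit Defensive.

(* A simple graph is a symmetric irreflexive adjacency relation [e] on a finite
   type [T].  A path is the nonempty sequence of its vertices in order; a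
   sequence and its reversal encode the same undirected path. *)
Definition simple_graph (T : finType) (e : rel T) : Prop :=
  symmetric e /\ irreflexive e.

Definition is_path (T : finType) (e : rel T) (P : seq T) : bool :=
  if P is x :: P' then path e x P' && uniq (x :: P') else false.

Definition path_length (T : finType) (P : seq T) : nat := (size P).-1.

Definition path_vertices (T : finType) (P : seq T) : {set T} := [set x in P].

Definition longest_path (T : finType) (e : rel T) (P : seq T) : Prop :=
  is_path e P /\
  forall P' : seq T, is_path e P' -> path_length P' <= path_length P.

Definition path_between (T : finType) (e : rel T) (u v : T) (P : seq T) : bool :=
  [&& is_path e P, head u P == u & last u P == v].

Definition internal_vertices (T : finType) (u v : T) (P : seq T) : {set T} :=
  [set x in P | (x != u) && (x != v)].

(* The duplicate-free sequence [Ps] is the set of [k] distinct paths.  All its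
   members run from [u] to [v] with [u != v], so equality of sequences is
   equality of paths; in particular the edge [u v] counts at most once. *)
Definition k_connected (T : finType) (e : rel T) (k : nat) : Prop :=
  2 <= #|T| /\
  forall u v : T, u != v ->
    exists Ps : seq (seq T),
      [/\ uniq Ps,
          size Ps = k,
          {in Ps, forall P, path_between e u v P}
        & {in Ps &, forall P Q, P != Q ->
            [disjoint internal_vertices u v P & internal_vertices u v Q]}].

(* Main.v *)
Require Import Defs.
From mathcomp Require Import all_boot all_order all_algebra.
From mathcomp Require Import zify.

(** Write [n] for the number of vertices, [L] for the common number of vertices
    of the longest paths [P] and [Q], and [s] for the number of vertices that
    they share.  The proof needs only two consequences of [k]-connectivity:
    the graph is connected, and every vertex has at least [k] neighbours, since
    the second vertices of [k] internally disjoint paths out of a vertex are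
    distinct ([k_connected_degree]).  By Dirac's theorem
    ([longest_path_dirac]) a longest path of a connected graph of minimum degree
    at least [k] is Hamiltonian or has at least [2k + 1] vertices.

    If [P] and [Q] are Hamiltonian, then [s = n >= k].  Otherwise, counting the
    union of [P] and [Q] gives [4k + 2 - s <= 2L - s <= n <= 3k + 2], that is
    [s >= k].

    Dirac's theorem is proved by rotation and closure.  All neighbours of both
    ends of a longest path lie on it; if it has at most [2k] vertices, then by
    the pigeonhole principle two consecutive vertices [w], [y] of the path are
    such that its first vertex is adjacent to [y] and its last one to [w]
    ([crossing_chords]), so that some cycle has the same vertices as the path.
    By connectivity a vertex missed by this cycle would yield a longer path. *)

Set Implicit Arguments.
Unset Strict Implicit.
Unset Printing Implicit Defensive.

(** Each of [k] internally disjoint paths from [u] to some [v] is determined by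
    its second vertex: a common second vertex would be internal to two of the
    paths, unless it is [v], in which case both paths are the edge [u v]. *)
Lemma k_connected_degree (T : finType) (e : rel T) (k : nat) :
  k_connected e k -> forall u : T, k <= #|[set v | e u v]|.
Proof.
case=> cardT conn u.
have [v neq_uv] : exists v, u != v.
  have /card_gt0P[v] : 0 < #|predC1 u|.
    by move: (cardC1 u); rewrite -subn1; lia.
  by rewrite inE eq_sym; exists v.
have [Ps [uniqPs <- pathPs disjPs]] := conn u v neq_uv.
pose second (P : seq T) := nth u P 1.
have shape P : P \in Ps ->
    exists y p, [/\ P = [:: u, y & p], e u y, uniq [:: u, y & p]
                  & last y p = v].
  move=> /pathPs /and3P[]; case: P => [|x [|y p]] //.
    by move=> _ /eqP xu /eqP xv; rewrite -xu -xv eqxx in neq_uv.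
  move=> /andP[/andP[exy _] uniqP] /eqP xu /eqP yv.
  by exists y, p; rewrite -xu; split.
have inj_second : {in Ps &, injective second}.
  move=> P Q PPs QPs; apply: contra_eq => neqPQ.
  have := disjPs P Q PPs QPs neqPQ.
  have [y [p [defP _ uniqP lastP]]] := shape P PPs.
  have [y' [q [defQ _ uniqQ lastQ]]] := shape Q QPs.
  rewrite defP defQ /second /=; apply: contraTneq => eqy; subst y'.
  have [eq_yv | neq_yv] := eqVneq y v.
    have tail_nil r : last y r = v -> uniq [:: u, y & r] -> r = [::].
      case: r => //= z r lastr /and3P[_ + _].
      by rewrite eq_yv -{1}lastr mem_last.
    have p_nil := tail_nil p lastP uniqP.
    have q_nil := tail_nil q lastQ uniqQ.
    by rewrite defP defQ p_nil q_nil eqxx in neqPQ.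
  have neq_yu : y != u.
    by move: uniqP => /= /andP[]; rewrite inE negb_or eq_sym => /andP[].
  apply/pred0Pn; exists y.
  by rewrite /= !inE neq_yu neq_yv eqxx orbT.
rewrite -(size_map second) cardE; apply: uniq_leq_size.
  by rewrite map_inj_in_uniq.
move=> w /mapP[P PPs ->]; rewrite mem_enum inE.
by have [y [p [-> euy _ _]]] := shape P PPs.
Qed.

Lemma k_connected_connect (T : finType) (e : rel T) (k : nat) :
  0 < k -> k_connected e k -> forall u v : T, connect e u v.
Proof.
move=> k_gt0 [_ conn] u v; have [-> //|neq_uv] := eqVneq u v.
have [[|P Ps] [_ sizePs pathPs _]] := conn u v neq_uv.
  by rewrite -sizePs in k_gt0.
have /and3P[] := pathPs P (mem_head _ _).
case: P {sizePs pathPs} => //= x p /andP[exp _] /eqP<- /eqP<-.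
by apply/connectP; exists p.
Qed.

Section LongestPaths.

Variables (T : finType) (e : rel T).
Hypothesis sym_e : symmetric e.

Lemma is_path_rev (P : seq T) : is_path e P -> is_path e (rev P).
Proof.
case: P => // x p /andP[exp uniqP].
rewrite /is_path lastI rev_rcons rev_path -rev_rcons -lastI rev_uniq uniqP andbT.
by rewrite (eq_path (e' := e)) // => a b; rewrite sym_e.
Qed.

Lemma longest_path_size (P Q : seq T) :
  longest_path e P -> is_path e Q -> size Q <= size P.
Proof.
case=> pathP maxP pathQ; have := maxP Q pathQ; rewrite /path_length.
by case: P pathP {maxP} => // x p _; case: Q pathQ.
Qed.

Lemma longest_path_head_neighbour (x y : T) (p : seq T) :
  longest_path e (x :: p) -> e x y -> y \in x :: p.
Proof.
move=> longP exy; apply/idPn => yNP.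
have /andP[exp uniqP] : is_path e (x :: p) by case: longP.
have := longest_path_size (Q := y :: x :: p) longP.
by rewrite /is_path /= sym_e exy exp yNP -cons_uniq uniqP ltnn; move/(_ isT).
Qed.

Lemma longest_path_last_neighbour (x y : T) (p : seq T) :
  longest_path e (x :: p) -> e (last x p) y -> y \in x :: p.
Proof.
move=> longP ezy.
rewrite -mem_rev lastI rev_rcons.
apply: longest_path_head_neighbour => //; rewrite -rev_rcons -lastI.
have [pathP maxP] := longP; split; first exact: is_path_rev.
by move=> Q /maxP; rewrite /path_length size_rev.
Qed.

(** The first vertex of the path is adjacent to [y], and its last vertex to the
    predecessor of [y]; reversing the segment that starts at [y] closes the
    path up.  The closed sequence may be degenerate, a single edge traversed
    back and forth, which is harmless below. *)
Lemma cycle_of_crossing_chords (x y : T) (p1 p2 : seq T) :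
  path e x (p1 ++ y :: p2) -> e x y -> e (last y p2) (last x p1) ->
  cycle e (x :: p1 ++ rev (y :: p2)).
Proof.
rewrite cat_path /= => /and3P[ep1 _ ep2] exy ezw.
have -> : rcons (p1 ++ rev (y :: p2)) x
          = p1 ++ last y p2 :: rev (x :: belast y p2).
  by rewrite rcons_cat -rev_cons (lastI x (y :: p2)) rev_rcons.
rewrite cat_path ep1 /= sym_e ezw /=.
have := rev_path e x (y :: p2); rewrite /= => ->.
rewrite sym_e exy /= (eq_path (e' := e)) // => a b; exact: sym_e.
Qed.

(** In a connected graph, a cycle on as many vertices as a longest path is
    Hamiltonian: an edge leaving it would start a longer path. *)
Lemma longest_cycle_spanning (P c : seq T) :
  (forall u v, connect e u v) -> longest_path e P ->
  0 < size c -> cycle e c -> uniq c -> size c = size P ->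
  forall y, y \in c.
Proof.
move=> conn longP + cyc uniqc sizec y.
case def_c: c => [|a c'] // _; rewrite -def_c.
have clos : closed e [in c].
  apply: intro_closed => [u v|u v euv cu]; first by rewrite !conn.
  apply/idPn => cNv.
  have [i q rot_c] := rot_to cu.
  (* Leaving [v] and then going once around the cycle from [u]. *)
  have := longest_path_size (Q := v :: rot i c) longP.
  rewrite /is_path cons_uniq mem_rot cNv rot_uniq uniqc /= size_rot sizec ltnn.
  move: cyc; rewrite -(rot_cycle i) rot_c /= rcons_path => /andP[-> _].
  by rewrite sym_e euv => /(_ isT).
by rewrite -(closed_connect clos (conn a y)) def_c inE eqxx.
Qed.

Hypothesis irr_e : irreflexive e.

Lemma crossing_chords (k : nat) (x : T) (p : seq T) :
  (forall u, k <= #|[set v | e u v]|) -> longest_path e (x :: p) ->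
  size p < k.*2 ->
  exists y p1 p2,
    [/\ p = p1 ++ y :: p2, e x y & e (last y p2) (last x p1)].
Proof.
move=> degk longP ltpk; pose z := last x p.
(* Both sets of chords are indexed by the edges of the path. *)
pose A := [set i : 'I_(size p) | e x (nth x p i)].
pose B := [set i : 'I_(size p) | e z (nth x (x :: p) i)].
have leA : k <= #|A|.
  apply: leq_trans (degk x) _.
  apply: leq_trans (leq_imset_card (fun i : 'I_(size p) => nth x p i) A).
  apply/subset_leq_card/subsetP => y; rewrite inE => exy.
  have := longest_path_head_neighbour longP exy.
  rewrite inE => /predU1P[yx|/(nthP x)[i ltip def_y]].
    by rewrite yx irr_e in exy.
  by apply/imsetP; exists (Ordinal ltip); rewrite ?inE /= def_y.
have leB : k <= #|B|.
  apply: leq_trans (degk z) _.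
  apply: leq_trans
    (leq_imset_card (fun i : 'I_(size p) => nth x (x :: p) i) B).
  apply/subset_leq_card/subsetP => y; rewrite inE => ezy.
  have : y \in rcons (belast x p) z.
    by rewrite -lastI; apply: longest_path_last_neighbour.
  rewrite mem_rcons inE => /predU1P[yz|yp].
    by rewrite yz irr_e in ezy.
  have [i ltip def_y] := nthP x yp; rewrite size_belast in ltip.
  have {}def_y : nth x (x :: p) i = y.
    by rewrite lastI nth_rcons size_belast ltip.
  apply/imsetP; exists (Ordinal ltip); last by rewrite -def_y.
  by move: ezy; rewrite inE -def_y.
have /card_gt0P[i] : 0 < #|A :&: B|.
  have leU : #|A :|: B| <= size p by rewrite -[leqRHS]card_ord max_card.
  have := cardsUI A B; lia.
rewrite !inE => /andP[exy ezw].
have lti := ltn_ord i.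
have def_p : p = take i p ++ nth x p i :: drop i.+1 p.
  by rewrite -drop_nth // cat_take_drop.
exists (nth x p i), (take i p), (drop i.+1 p); split=> //.
have -> : last (nth x p i) (drop i.+1 p) = z.
  by have := congr1 (last x) def_p; rewrite last_cat /= => <-.
suff -> : last x (take i p) = nth x (x :: p) i by [].
case: (nat_of_ord i) lti => [|j] ltj; first by rewrite take0.
by rewrite (take_nth x) ?last_rcons // ltnW.
Qed.

(** Dirac's theorem on longest paths. *)
Theorem longest_path_dirac (k : nat) (P : seq T) :
  (forall u v, connect e u v) -> (forall u, k <= #|[set v | e u v]|) ->
  longest_path e P -> minn #|T| k.*2.+1 <= size P.
Proof.
move=> conn degk longP; rewrite geq_min orbC.
case: leqP => //= lePk.
case: P => [|x p] in longP lePk *; first by case: longP.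
have [y [p1 [p2 [def_p exy ezw]]]] := crossing_chords degk longP lePk.
have /andP[exp uniqP] : is_path e (x :: p) by case: longP.
pose c := x :: p1 ++ rev (y :: p2).
have perm_c : perm_eq c (x :: p).
  by rewrite /c def_p perm_cons perm_cat2l perm_rev.
have cyc : cycle e c by apply: cycle_of_crossing_chords; rewrite -?def_p.
have uniqc : uniq c by rewrite (perm_uniq perm_c).
have c_gt0 : 0 < size c by [].
have span :=
  longest_cycle_spanning conn longP c_gt0 cyc uniqc (perm_size perm_c).
rewrite -(perm_size perm_c) cardE; apply: uniq_leq_size (enum_uniq _) _.
by move=> w _; apply: span.
Qed.

Lemma card_path_vertices (P : seq T) :
  is_path e P -> #|path_vertices P| = size P.
Proof. by case: P => // x p /andP[_ /card_uniqP<-]; rewrite cardsE. Qed.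

End LongestPaths.

Theorem corollary3p2 (k : nat) (T : finType) (e : rel T) :
  1 <= k ->
  simple_graph e ->
  k_connected e k ->
  ((#|T|%:R - 2%:R) / 3%:R <= k%:R :> rat)%R ->
  forall P Q : seq T,
    longest_path e P -> longest_path e Q ->
    k <= #|path_vertices P :&: path_vertices Q|.
Proof.
move=> k_gt0 [sym_e irr_e] kconn le_n P Q longP longQ.
have {}le_n : #|T| <= 3 * k + 2.
  move: le_n; rewrite Num.Theory.ler_pdivrMr ?Num.Theory.ltr0n //.
  rewrite Num.Theory.lerBlDr -GRing.natrM -GRing.natrD Num.Theory.ler_nat.
  by rewrite mulnC.
have conn := k_connected_connect k_gt0 kconn.
have degk := k_connected_degree kconn.
have pathP : is_path e P by case: longP.
have pathQ : is_path e Q by case: longQ.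
have le_kn : k <= #|T|.
  by case: P pathP {longP} => // x _ _; apply: leq_trans (degk x) (max_card _).
have leP := longest_path_dirac sym_e irr_e conn degk longP.
have leQ := longest_path_dirac sym_e irr_e conn degk longQ.
have leU : #|path_vertices P :|: path_vertices Q| <= #|T| by apply: max_card.
have := cardsUI (path_vertices P) (path_vertices Q).
rewrite (card_path_vertices pathP) (card_path_vertices pathQ).
lia.
Qed.
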